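(* Let $L:\mathbb{R}^D\to\mathbb{R}$ be $\mathcal{C}^4$ and let $\Gamma\subset\mathbb{R}^D$ be a $\mathcal{C}^2$ submanifold of dimension $D-M$, for some integer $1\le M\le D$, such that every $x\in\Gamma$ is a local minimizer of $L$ and $\mathrm{rank}(\nabla^2L(x))=M$. Then the worst-direction sharpness $$R^{\mathrm{Max}}_\rho(x)=\max_{\|v\|_2\le1}L(x+\rho v)-L(x)$$ admits $\lambda_1(\nabla^2L(\cdot))/2$ as a good limiting regularizer on $\Gamma$. Moreover it is mildly bounded below: for any bounded closed set $B\subset U$ there exists $C>0$ such that for all sufficiently small $\rho>0$ and all $x\in B$, $R^{\mathrm{Max}}_\rho(x)\ge-C\rho^2$. Here $U$ is the attraction set of $\Gamma$.
   Context: $\lambda_1(A)$ is the largest eigenvalue of a symmetric matrix $A$. Gradient flow: $\phi(x,\tau)=x-\int_0^\tau\nabla L(\phi(x,t))\,dt$, $\Phi(x)=\lim_{\tau\to\infty}\phi(x,\tau)$ when it exists; $U=\{x:\Phi(x)\text{ exists and }\Phi(x)\in\Gamma\}$. For a family of functions $R_\rho:\mathbb{R}^D\to\mathbb{R}\cup\{\infty\}$, $\rho>0$, the limiting regularizer is $S:\Gamma\to\mathbb{R}$, $S(x)=\lim_{\rho\to0}\lim_{r\to0}\inf_{\|x'-x\|_2\le r}R_\rho(x')/\rho^2$. The limiting regularizer $S$ is good around $x^*\in\Gamma$ if $S$ is non-negative and continuous at $x^*$ and there is an open set $V_{x^*}\ni x^*$ such that for any $C,\epsilon>0$ there is $\rho_{x^*}>0$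 with $\bigl|S(x)-\inf_{\|x'-x\|_2\le C\rho}R_\rho(x')/\rho^2\bigr|<\epsilon$ for all $x\in\Gamma\cap V_{x^*}$ and all $0<\rho\le\rho_{x^*}$. $\{R_\rho\}$ admits $S$ as a good limiting regularizer on $\Gamma$ if $S$ is its limiting regularizer and is good around every point of $\Gamma$. *)

(* Defs.v *)
From HB Require Import structures.
From mathcomp Require Import all_boot all_order all_algebra.
From mathcomp Require Import all_classical all_reals all_analysis.

Set Implicit Arguments.
Unset Strict Implicit.
Unset Printing Implicit Defensive.

Import Order.TTheory GRing.Theory Num.Theory.
Import numFieldNormedType.Exports.

Local Open Scope classical_set_scope.
Local Open Scope ring_scope.

(* Points of R^D are row vectors. The library norm on 'rV[R]_D is the sup
   norm; it yields the usual topology and the usual bounded sets, but metric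
   balls below are Euclidean and use [norm2]. *)
Definition norm2 (R : realType) (D : nat) (v : 'rV[R]_D) : R :=
  Num.sqrt (\sum_(i < D) v 0 i ^+ 2).

Definition partial (R : realType) (D : nat) (i : 'I_D) (f : 'rV[R]_D -> R)
    (x : 'rV[R]_D) : R :=
  'D_(delta_mx 0 i) f x.

(* Meant for open W: all partial derivatives of order at most k exist and are
   continuous on W. *)
Fixpoint Ck_on (R : realType) (D k : nat) (W : set 'rV[R]_D)
    (f : 'rV[R]_D -> R) : Prop :=
  (forall x, W x -> {for x, continuous f}) /\
  match k with
  | 0%N => True
  | k'.+1 => forall i : 'I_D,
      (forall x, W x -> derivable f x (delta_mx 0 i)) /\
      Ck_on k' W (partial i f)
  end.

Definition Ck_map_on (R : realType) (D E k : nat) (W : set 'rV[R]_D)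
    (f : 'rV[R]_D -> 'rV[R]_E) : Prop :=
  forall j : 'I_E, Ck_on k W (fun x => f x 0 j).

(* psi, with inverse phi, is a C^k diffeomorphism from the open set W onto the
   open set psi @` W. *)
Definition Ck_diffeo_on (R : realType) (D k : nat) (W : set 'rV[R]_D)
    (psi phi : 'rV[R]_D -> 'rV[R]_D) : Prop :=
  [/\ open W, open (psi @` W), {in W, cancel psi phi},
      Ck_map_on k W psi & Ck_map_on k (psi @` W) phi].

(* Embedded C^k submanifold of R^D of dimension d <= D: around each of its
   points a C^k chart of R^D flattens it to R^d x {0}. *)
Definition is_submanifold (R : realType) (D k d : nat) (Gamma : set 'rV[R]_D)
    : Prop :=
  forall x, Gamma x ->
    exists (W : set 'rV[R]_D) (psi phi : 'rV[R]_D -> 'rV[R]_D),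
      [/\ W x, Ck_diffeo_on k W psi phi &
        forall y, W y ->
          (Gamma y <-> forall i : 'I_D, (d <= i)%N -> psi y 0 i = 0)].

Definition local_minimizer (R : realType) (D : nat) (L : 'rV[R]_D -> R)
    (x : 'rV[R]_D) : Prop :=
  \forall y \near x, L x <= L y.

Definition gradient (R : realType) (D : nat) (L : 'rV[R]_D -> R)
    (x : 'rV[R]_D) : 'rV[R]_D :=
  \row_(i < D) partial i L x.

Definition hessian (R : realType) (D : nat) (L : 'rV[R]_D -> R)
    (x : 'rV[R]_D) : 'M[R]_D :=
  \matrix_(i < D, j < D) partial i (partial j L) x.

(* For a symmetric matrix of positive size the set is finite and nonempty, so
   this is the largest eigenvalue. *)
Definition lambda1 (R : realType) (D : nat) (A : 'M[R]_D) : R :=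
  sup [set a : R | eigenvalue A a].

(* The integral of the vector-valued integrand is taken componentwise. *)
Definition is_gradient_flow (R : realType) (D : nat) (L : 'rV[R]_D -> R)
    (x : 'rV[R]_D) (phi : R -> 'rV[R]_D) : Prop :=
  {within `[0, +oo[, continuous phi} /\
  forall tau : R, 0 <= tau ->
    phi tau = x - \row_(i < D)
      \int[lebesgue_measure]_(t in `[0, tau]) (gradient L (phi t) 0 i).

(* The flow need not exist for all times, so its existence is part of the
   existence of the limit Phi(x). *)
Definition attraction_set (R : realType) (D : nat) (L : 'rV[R]_D -> R)
    (Gamma : set 'rV[R]_D) : set 'rV[R]_D :=
  [set x | exists (phi : R -> 'rV[R]_D) (y : 'rV[R]_D),
    [/\ is_gradient_flow L x phi, phi t @[t --> +oo] --> y & Gamma y]].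

Definition inf_ball (R : realType) (D : nat) (Rg : R -> 'rV[R]_D -> \bar R)
    (rho r : R) (x : 'rV[R]_D) : \bar R :=
  ereal_inf [set (Rg rho x' / (rho ^+ 2)%:E)%E |
             x' in [set x' | norm2 (x' - x) <= r]].

(* The inner limit always exists in \bar R, as [inf_ball] is nonincreasing
   in r. *)
Definition is_limiting_regularizer (R : realType) (D : nat)
    (Rg : R -> 'rV[R]_D -> \bar R) (S : 'rV[R]_D -> R)
    (Gamma : set 'rV[R]_D) : Prop :=
  forall x, Gamma x ->
    (lim (inf_ball Rg rho r x @[r --> 0^'+])) @[rho --> 0^'+] --> (S x)%:E.

(* S is only meaningful on Gamma, hence the relative continuity. *)
Definition good_around (R : realType) (D : nat)
    (Rg : R -> 'rV[R]_D -> \bar R) (S : 'rV[R]_D -> R)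
    (Gamma : set 'rV[R]_D) (xs : 'rV[R]_D) : Prop :=
  [/\ 0 <= S xs,
      S @ within Gamma (nbhs xs) --> S xs &
      exists V : set 'rV[R]_D, [/\ open V, V xs &
        forall C eps : R, 0 < C -> 0 < eps ->
          exists2 rhos : R, 0 < rhos &
            forall (x : 'rV[R]_D) (rho : R), Gamma x -> V x ->
              0 < rho -> rho <= rhos ->
                (`|(S x)%:E - inf_ball Rg rho (C * rho) x| < eps%:E)%E]].

(* The first clause says that the family takes values in R together with
   +oo. *)
Definition admits_good_limiting_regularizer (R : realType) (D : nat)
    (Rg : R -> 'rV[R]_D -> \bar R) (S : 'rV[R]_D -> R)
    (Gamma : set 'rV[R]_D) : Prop :=
  [/\ forall (rho : R) x, 0 < rho -> Rg rho x != -oo%E,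
      is_limiting_regularizer Rg S Gamma &
      forall xs, Gamma xs -> good_around Rg S Gamma xs].

Definition mildly_bounded_below (R : realType) (D : nat)
    (Rg : R -> 'rV[R]_D -> \bar R) (U : set 'rV[R]_D) : Prop :=
  forall B : set 'rV[R]_D, bounded_set B -> closed B -> B `<=` U ->
    exists2 C : R, 0 < C &
      \forall rho \near 0^'+, forall x, B x ->
        ((- (C * rho ^+ 2))%:E <= Rg rho x)%E.

(* The supremum is a maximum when L is continuous, by compactness of the
   Euclidean unit ball. *)
Definition max_sharpness (R : realType) (D : nat) (L : 'rV[R]_D -> R)
    (rho : R) (x : 'rV[R]_D) : \bar R :=
  (ereal_sup [set (L (x + rho *: v))%:E | v in [set v | (norm2 v <= 1)%R]]
   - (L x)%:E)%E.

(* Main.v *)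
Require Import Defs.
From HB Require Import structures.
From mathcomp Require Import all_boot all_order all_algebra.
From mathcomp Require Import all_classical all_reals all_analysis.
From mathcomp Require Import ring lra.

Set Implicit Arguments.
Unset Strict Implicit.
Unset Printing Implicit Defensive.

Import Order.TTheory GRing.Theory Num.Theory.
Import numFieldNormedType.Exports.

Local Open Scope classical_set_scope.
Local Open Scope ring_scope.

(* Since v = 0 is allowed, the sharpness is nonnegative, which gives the mild
   lower bound. For the rest, let q_x be the quadratic form of the Hessian at x;
   by Schwarz's theorem the Hessian is symmetric, so lambda1 is the maximum of
   its Rayleigh quotient, and third derivatives make x |-> q_x locally
   Lipschitz. The gradient vanishes at every x in Gamma, so Taylor's formula at
   x gives R_rho(x) <= (lambda1 / 2 + eps) rho^2 for small rho.
   Conversely, at x' with |x' - x| <= C rho, move by rho along a unit top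
   eigenvector of the Hessian at x, oriented so that the first-order term is
   nonnegative: this gives R_rho(x') >= (lambda1 / 2 - eps) rho^2 although the
   gradient need not vanish at x'. Both bounds are uniform in x. *)

(** * Derivatives along lines and along arbitrary directions *)

Lemma Ck_on_continuous (R : realType) (D k : nat) (f : 'rV[R]_D -> R) :
  Ck_on k setT f -> continuous f.
Proof. by case: k => [|k] [cf _] x; exact: cf. Qed.

Lemma Ck_on_partial (R : realType) (D k : nat) (W : set 'rV[R]_D) f (i : 'I_D) :
  Ck_on k.+1 W f -> Ck_on k W (partial i f).
Proof. by case=> _ /(_ i)[]. Qed.

Lemma Ck_on_is_derive (R : realType) (D k : nat) (f : 'rV[R]_D -> R) i x :
  Ck_on k.+1 setT f -> is_derive x (delta_mx 0 i) f (partial i f x).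
Proof. by case=> _ /(_ i)[df _]; exact/derivableP/df. Qed.

Lemma is_derive_line (R : realType) (V : normedModType R) (f : V -> R)
    (x v : V) (t d : R) :
  is_derive (x + t *: v) v f d -> is_derive t 1 (fun s : R => f (x + s *: v)) d.
Proof.
have E : (fun h : R => h^-1 *: (((fun s => f (x + s *: v)) \o shift t) (h *: 1)
             - f (x + t *: v))) =
         (fun h : R => h^-1 *: ((f \o shift (x + t *: v)) (h *: v)
             - f (x + t *: v))).
  apply/funext => h /=; congr (_ *: (f _ - _)).
  by rewrite [h *: 1]mulr1 scalerDl addrCA.
move=> [df dE]; split; first by rewrite /derivable E.
by rewrite /derive E.
Qed.

(** The step [s] may have either sign, so the intermediate point is located by [|c| <= |s|];
    negative steps apply the mean value theorem on [[s, 0]]. *)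
Lemma MVT_line (R : realType) (V : normedModType R) (f df : V -> R) (x v : V)
    (s : R) :
  (forall y, is_derive y v f (df y)) ->
  exists2 c : R, `|c| <= `|s| & f (x + s *: v) - f x = df (x + c *: v) * s.
Proof.
move=> dfv.
have dg (t : R) : is_derive t 1 (fun s : R => f (x + s *: v)) (df (x + t *: v)).
  exact: is_derive_line.
have cg (a b : R) : {within `[a, b], continuous (fun s : R => f (x + s *: v))}.
  by apply: derivable_within_continuous => t _; apply: ex_derive.
have [s0|s0] := leP 0 s.
- have [c] := MVT_segment s0 (fun t _ => dg t) (@cg 0 s).
  rewrite in_itv /= scale0r addr0 subr0 => /andP[c0 cs] ->.
  by exists c => //; rewrite !ger0_norm.
- have [c] := MVT_segment (ltW s0) (fun t _ => dg t) (@cg s 0).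
  rewrite in_itv /= scale0r addr0 sub0r => /andP[c0 cs] fE.
  exists c; first by rewrite !ler0_norm ?lerN2// ltW.
  by rewrite -opprB fE mulrN opprK.
Qed.

(** The increment along [h (a u + w)] is split at [x + h w]. The part along [w] converges by
    hypothesis. The part along [u] is, by the mean value theorem, [h a] times [df] at a point
    tending to [x], so continuity of [df] at [x] gives the limit [a * df x]. *)
Lemma is_deriveD_dir (R : realType) (V : normedModType R) (f df : V -> R)
    (u w x : V) (a : R) :
  (forall y, is_derive y u f (df y)) -> {for x, continuous df} ->
  derivable f x w -> is_derive x (a *: u + w) f (a * df x + 'D_w f x).
Proof.
move=> dfu cdf fw.
suff H : (fun h : R => h^-1 *: ((f \o shift x) (h *: (a *: u + w)) - f x)) @ 0^'
    --> a * df x + 'D_w f x.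
  by split; [apply/cvg_ex; eexists; exact: H|apply/cvg_lim => //; exact: H].
have -> : (fun h : R => h^-1 *: ((f \o shift x) (h *: (a *: u + w)) - f x)) =
  (fun h => h^-1 * (f ((x + h *: w) + (h * a) *: u) - f (x + h *: w))) \+
  (fun h : R => h^-1 *: ((f \o shift x) (h *: w) - f x)).
  apply/funext => h /=; rewrite -[X in _ = _ + X]/(_ * _) -[LHS]/(_ * _) -mulrDr.
  congr (_ * _); rewrite scalerDr scalerA (addrC (h *: w)).
  rewrite addrA subrK; congr (f _ - _).
  by rewrite addrC (addrC _ (h *: w)) addrA.
apply: cvgD; last exact: fw.
apply/cvgrPdist_le => e e0.
have [r r0 Hr] : exists2 r : R, 0 < r &
    forall z, `|x - z| < r -> `|a * df x - a * df z| <= e.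
  have /cvgrPdist_le /(_ e e0) : a * df z @[z --> x] --> a * df x.
    by apply: cvgM => //; exact: cvg_cst.
  rewrite near_simpl => /nbhs_normP[r /= r0 Hr]; exists r => //.
near=> h.
have h0 : h != 0 by near: h; exact: nbhs_dnbhs_neq.
have [c cle ->] := MVT_line (x + h *: w) (h * a) dfu.
rewrite [X in _ - X](_ : _ = a * df (x + h *: w + c *: u)); last by field.
apply: Hr; rewrite opprD addrA opprD addrA subrr add0r -opprD normrN.
apply: le_lt_trans (ler_normD _ _) _; rewrite !normrZ.
(* The intermediate point is at distance at most [|h| (|w| + |a| |u|)] from [x]; the added 1 keeps
   the divisor positive when [w] and [a u] vanish. *)
have : `|h| * (`|w| + `|a| * `|u| + 1) < r.
  rewrite -ltr_pdivlMr; last by rewrite ltr_wpDl// addr_ge0// mulr_ge0.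
  near: h; apply: dnbhs0_lt; rewrite divr_gt0// ltr_wpDl// addr_ge0// mulr_ge0.
apply: le_lt_trans; rewrite mulrDr mulrDr -addrA lerD2l.
rewrite normrM in cle.
by rewrite ler_wpDr ?mulr_ge0// mulrA ler_wpM2r.
Unshelve. all: by end_near. Qed.

(** The direction is expanded in the standard basis and its coordinates are added one at a time with
    [is_deriveD_dir], so total differentiability is never invoked. *)
Lemma is_derive_partial (R : realType) (D k : nat) (f : 'rV[R]_D -> R)
    (x v : 'rV[R]_D) :
  Ck_on k.+1 setT f -> is_derive x v f (\sum_i v 0 i * partial i f x).
Proof.
move=> hf; rewrite [X in is_derive x X](row_sum_delta v).
elim/big_rec2: _ => [|i d w _ [dw <-]]; first exact: is_derive0.
apply: is_deriveD_dir => //.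
- by move=> y; apply: Ck_on_is_derive hf.
- exact/Ck_on_continuous/(Ck_on_partial _ hf).
Qed.

(** * Symmetry of second derivatives *)

(** Two mean value steps: first along [v] for [y |-> f (y + s w) - f y], then along [w] for [fv]. *)
Lemma double_difference (R : realType) (V : normedModType R)
    (f fv fvw : V -> R) (x v w : V) (s : R) :
  (forall y, is_derive y v f (fv y)) -> (forall y, is_derive y w fv (fvw y)) ->
  exists c d : R, [/\ `|c| <= `|s|, `|d| <= `|s| &
    f (x + s *: w + s *: v) - f (x + s *: w) - (f (x + s *: v) - f x) =
    fvw (x + c *: v + d *: w) * s ^+ 2].
Proof.
move=> dfv dfvw.
have dg y : is_derive y v (fun y => f (y + s *: w) - f y) (fv (y + s *: w) - fv y).
  apply: is_deriveB.
  have [dv E] := dfv (y + s *: w).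
  have E' : (fun h : R => h^-1 *: (((fun y => f (y + s *: w)) \o shift y) (h *: v)
       - f (y + s *: w))) =
    (fun h : R => h^-1 *: ((f \o shift (y + s *: w)) (h *: v) - f (y + s *: w))).
    by apply/funext => h /=; rewrite addrA.
  by split; [rewrite /derivable E'|rewrite /derive E'].
have [c cs] := MVT_line x s dg; have [d ds] := MVT_line (x + c *: v) s dfvw.
move=> fvE fE; exists c, d; split => //.
transitivity (f (x + s *: v + s *: w) - f (x + s *: v) - (f (x + s *: w) - f x)).
  have aux (p q u t : R) : p - q - (u - t) = p - u - (q - t) by ring.
  by rewrite aux (addrAC x (s *: w)).
by rewrite fE fvE expr2 mulrA.
Qed.

(** The second difference is symmetric in the two directions. Divided by [s ^ 2], it is a value of
    each mixed partial near [x]; by continuity both mixed partials at [x] are within [e / 2] of this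
    common value. *)
Lemma partialC (R : realType) (D k : nat) (f : 'rV[R]_D -> R)
    (x : 'rV[R]_D) (i j : 'I_D) :
  Ck_on k.+2 setT f -> partial i (partial j f) x = partial j (partial i f) x.
Proof.
move=> hf.
have cij a b : {for x, continuous (partial a (partial b f))}.
  exact/Ck_on_continuous/Ck_on_partial/Ck_on_partial/hf.
have dd a y : is_derive y (delta_mx 0 a) f (partial a f y).
  exact: Ck_on_is_derive hf.
have ddd a b y : is_derive y (delta_mx 0 a) (partial b f) (partial a (partial b f) y).
  exact/Ck_on_is_derive/Ck_on_partial/hf.
apply/eqP; rewrite -subr_eq0 -normr_le0; apply/ler_addgt0Pl => e e0; rewrite addr0.
have e20 : 0 < e / 2 by rewrite divr_gt0.
have := cij i j => /cvgrPdist_le /(_ _ e20); rewrite near_simpl => /nbhs_normP[r r0 Hr].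
have := cij j i => /cvgrPdist_le /(_ _ e20); rewrite near_simpl => /nbhs_normP[r' r0' Hr'].
pose N := `|delta_mx 0 i : 'rV[R]_D| + `|delta_mx 0 j : 'rV[R]_D|.
have N0 : 0 <= N by rewrite addr_ge0.
(* The step is small enough that both intermediate points fall within both continuity radii. *)
pose s := Num.min r r' / (N + 1).
have m0 : 0 < Num.min r r' by rewrite lt_min r0.
have s0 : 0 < s by rewrite divr_gt0// ltr_wpDl.
have sN : s * N < Num.min r r'.
  by rewrite /s mulrAC ltr_pdivrMr ?ltr_wpDl// ltr_pM2l// ltrDl.
have near_x (c d : R) a b : `|c| <= `|s| -> `|d| <= `|s| ->
    `|delta_mx 0 a : 'rV[R]_D| + `|delta_mx 0 b : 'rV[R]_D| = N ->
    `|x - (x + c *: delta_mx 0 a + d *: delta_mx 0 b)| < Num.min r r'.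
  move=> cs ds NE; apply: le_lt_trans sN.
  rewrite -addrA opprD addrA subrr add0r normrN.
  rewrite (le_trans (ler_normD _ _))// !normrZ -NE mulrDr.
  by rewrite (gtr0_norm s0) in cs ds; rewrite lerD// ler_wpM2r.
have [c [d [cs ds E]]] := double_difference x s (dd j) (ddd i j).
have [c' [d' [cs' ds' E']]] := double_difference x s (dd i) (ddd j i).
have H := Hr (x + c *: delta_mx 0 j + d *: delta_mx 0 i).
have H' := Hr' (x + c' *: delta_mx 0 i + d' *: delta_mx 0 j).
have {}H : `|partial i (partial j f) x - partial i (partial j f)
    (x + c *: delta_mx 0 j + d *: delta_mx 0 i)| <= e / 2.
  apply: H => /=; apply: lt_le_trans (near_x _ _ _ _ cs ds _) _.
    by rewrite addrC.
  by rewrite ge_min lexx.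
have {}H' : `|partial j (partial i f) x - partial j (partial i f)
    (x + c' *: delta_mx 0 i + d' *: delta_mx 0 j)| <= e / 2.
  apply: H' => /=; apply: lt_le_trans (near_x _ _ _ _ cs' ds' _) _ => //.
  by rewrite ge_min lexx orbT.
rewrite (addrAC x (s *: delta_mx 0 j)) in E'.
move: E E' H H'.
move: (partial i (partial j f) (x + c *: _ + _)) => p.
move: (partial j (partial i f) (x + c' *: _ + _)) => p'.
move=> E E'.
have E'' : p = p'.
  apply: (mulIf (lt0r_neq0 (exprn_gt0 2 s0))) => /=; rewrite -E -E'.
  ring.
move=> H; rewrite -E'' => H'.
apply: le_trans (ler_distD p _ _) _.
rewrite [leRHS]splitr; apply: lerD; first exact: H.
by rewrite distrC; exact: H'.
Qed.

Lemma trmx_hessian (R : realType) (D k : nat) (f : 'rV[R]_D -> R) x :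
  Ck_on k.+2 setT f -> (hessian f x)^T = hessian f x.
Proof. by move=> hf; apply/matrixP => i j; rewrite !mxE (partialC _ _ _ hf). Qed.

(** * The Hessian form and second-order Taylor bounds along a segment *)

Definition quad (R : realType) (D : nat) (A : 'M[R]_D) (v : 'rV[R]_D) : R :=
  (v *m A *m v^T) 0 0.

Lemma quadE (R : realType) (D : nat) (A : 'M[R]_D) (v : 'rV[R]_D) :
  quad A v = \sum_j v 0 j * \sum_i v 0 i * A i j.
Proof.
rewrite /quad mxE; apply: eq_bigr => j _; rewrite !mxE mulrC; congr (_ * _).
Qed.

Lemma quadN (R : realType) (D : nat) (A : 'M[R]_D) (v : 'rV[R]_D) :
  quad A (- v) = quad A v.
Proof. by rewrite /quad linearN/= mulmxN mulNmx mulNmx opprK. Qed.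

(** The derivative along [v] is a combination of partials with the fixed coefficients [v 0 i];
    differentiating each of them along [v] again produces the Hessian form. *)
Lemma is_derive2_quad (R : realType) (D k : nat) (f : 'rV[R]_D -> R)
    (x v : 'rV[R]_D) :
  Ck_on k.+2 setT f ->
  is_derive x v (fun y => \sum_i v 0 i * partial i f y) (quad (hessian f x) v).
Proof.
move=> hf; rewrite quadE.
have -> : (fun y => \sum_i v 0 i * partial i f y) =
          \sum_i (v 0 i \*: partial i f).
  by apply/funext => y; rewrite fct_sumE.
apply: is_derive_sum => i.
under eq_bigr do rewrite mxE.
by apply: is_deriveZ; exact: is_derive_partial (Ck_on_partial i hf).
Qed.

(** The mean value theorem gives [f1 t >= f1 0 + m t]. Hence [f] minus its quadratic model has
    nonnegative derivative on [[0, s]], and a second use of the theorem compares its endpoint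
    values. The sign of [m] is free. *)
Lemma taylor2_ge (R : realType) (f f1 f2 : R -> R) (s m : R) :
  (forall t : R, is_derive t 1 f (f1 t)) -> (forall t : R, is_derive t 1 f1 (f2 t)) ->
  0 <= s -> (forall t : R, 0 <= t <= s -> m <= f2 t) ->
  f 0 + f1 0 * s + m * s ^+ 2 / 2 <= f s.
Proof.
move=> df df1 s0 mf2.
have cf (g g1 : R -> R) (a b : R) : (forall t : R, is_derive t 1 g (g1 t)) ->
    {within `[a, b], continuous g}.
  by move=> dg; apply: derivable_within_continuous => t _; apply: ex_derive.
have f1ge (t : R) : 0 <= t <= s -> f1 0 + m * t <= f1 t.
  move=> /andP[t0 ts].
  have [c] := MVT_segment t0 (fun t _ => df1 t) (cf _ _ 0 t df1).
  rewrite in_itv/= subr0 => /andP[c0 ct] /eqP; rewrite subr_eq addrC => /eqP ->.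
  by rewrite lerD2l ler_wpM2r// mf2// c0 (le_trans ct).
pose h : R -> R := f - (fun t : R => f1 0 * t + m * t ^+ 2 / 2).
have dh (t : R) : is_derive t 1 h (f1 t - (f1 0 + m * t)).
  apply: is_deriveB.
  have -> : (fun t : R => f1 0 * t + m * t ^+ 2 / 2) =
      (f1 0 \*: id) + ((m / 2) \*: (id ^+ 2)).
    apply/funext => u /=; congr (_ + _); rewrite /=.
    by rewrite -[RHS]/(m / 2 * u ^+ 2); ring.
  apply: is_derive_eq; rewrite /GRing.scale/= mulr1 expr1; by field.
have [c] := MVT_segment s0 (fun t _ => dh t) (cf _ _ 0 s dh).
rewrite in_itv/= subr0 => cs hE.
have : 0 <= h s - h 0.
  by rewrite hE mulr_ge0// subr_ge0 f1ge.
rewrite /h -![(_ - _ : _ -> _) _]/(_ - _) /=; lra.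
Qed.

Lemma line_taylor_ge (R : realType) (D k : nat) (f : 'rV[R]_D -> R)
    (x v : 'rV[R]_D) (s m : R) :
  Ck_on k.+2 setT f -> 0 <= s ->
  (forall t : R, 0 <= t <= s -> m <= quad (hessian f (x + t *: v)) v) ->
  f x + (\sum_i v 0 i * partial i f x) * s + m * s ^+ 2 / 2 <= f (x + s *: v).
Proof.
move=> hf s0 mq.
have := @taylor2_ge R (fun t => f (x + t *: v))
  (fun t => \sum_i v 0 i * partial i f (x + t *: v))
  (fun t => quad (hessian f (x + t *: v)) v) s m.
rewrite scale0r addr0; apply => // t.
- exact/is_derive_line/(is_derive_partial _ _ hf).
- exact/(is_derive_line (f := fun y => \sum_i v 0 i * partial i f y))/(is_derive2_quad _ _ hf).
Qed.

Lemma line_taylor_le (R : realType) (D k : nat) (f : 'rV[R]_D -> R)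
    (x v : 'rV[R]_D) (s m : R) :
  Ck_on k.+2 setT f -> 0 <= s ->
  (forall t : R, 0 <= t <= s -> quad (hessian f (x + t *: v)) v <= m) ->
  f (x + s *: v) <= f x + (\sum_i v 0 i * partial i f x) * s + m * s ^+ 2 / 2.
Proof.
move=> hf s0 mq.
(* The upper bound is the lower bound for [- f], with [- m] in place of [m]. *)
have := @taylor2_ge R (- (fun t => f (x + t *: v)))
  (- (fun t => \sum_i v 0 i * partial i f (x + t *: v)))
  (- (fun t => quad (hessian f (x + t *: v)) v)) s (- m).
rewrite -![(- _ : _ -> _) _]/(- _) scale0r addr0 => H.
rewrite -lerN2; apply: le_trans (H _ _ s0 _); first lra.
- by move=> t; apply: is_deriveN; exact/is_derive_line/(is_derive_partial _ _ hf).
- move=> t; apply: is_deriveN.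
  exact/(is_derive_line (f := fun y => \sum_i v 0 i * partial i f y))/(is_derive2_quad _ _ hf).
- by move=> t /mq; rewrite -[(- _ : _ -> _) _]/(- _) lerN2.
Qed.

(** * The Euclidean norm, its comparison with the sup norm, and bounds on quadratic forms *)

Lemma sqr_norm2 (R : realType) (D : nat) (v : 'rV[R]_D) :
  norm2 v ^+ 2 = \sum_i v 0 i ^+ 2.
Proof. by rewrite sqr_sqrtr// sumr_ge0// => i _; rewrite sqr_ge0. Qed.

Lemma sqr_norm2_mx (R : realType) (D : nat) (v : 'rV[R]_D) :
  norm2 v ^+ 2 = (v *m v^T) 0 0.
Proof. by rewrite sqr_norm2 mxE; apply: eq_bigr => i _; rewrite mxE expr2. Qed.

Lemma norm2_ge0 (R : realType) (D : nat) (v : 'rV[R]_D) : 0 <= norm2 v.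
Proof. exact: sqrtr_ge0. Qed.

Lemma ler_coord_norm2 (R : realType) (D : nat) (v : 'rV[R]_D) i :
  `|v 0 i| <= norm2 v.
Proof.
rewrite -(ler_pXn2r (n := 2))// ?nnegrE ?norm2_ge0// sqr_norm2 real_normK ?num_real//.
by rewrite (bigD1 i)//= lerDl sumr_ge0// => j _; rewrite sqr_ge0.
Qed.

(** This carries Euclidean ball conditions over to the sup norm, in which the neighbourhoods and
    Lipschitz estimates are expressed. *)
Lemma ler_mxnorm_norm2 (R : realType) (D : nat) (v : 'rV[R]_D) : `|v| <= norm2 v.
Proof.
rewrite -[leLHS]/(mx_norm v) mx_normrE; apply/bigmax_leP; split; first exact: norm2_ge0.
by move=> [i j] _ /=; rewrite ord1 ler_coord_norm2.
Qed.

Lemma ler_coord_mxnorm (R : realType) (D : nat) (v : 'rV[R]_D) i : `|v 0 i| <= `|v|.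
Proof.
rewrite -[leRHS]/(mx_norm v) mx_normrE.
by apply/bigmax_geP; right => /=; exists (0, i).
Qed.

Lemma norm2N (R : realType) (D : nat) (v : 'rV[R]_D) : norm2 (- v) = norm2 v.
Proof. by congr Num.sqrt; apply: eq_bigr => i _; rewrite mxE sqrrN. Qed.

Lemma norm20 (R : realType) (D : nat) : norm2 (0 : 'rV[R]_D) = 0.
Proof. by rewrite /norm2 big1 ?sqrtr0// => i _; rewrite mxE expr0n. Qed.

Lemma norm2_delta (R : realType) (D : nat) (i : 'I_D) :
  norm2 (delta_mx 0 i : 'rV[R]_D) = 1.
Proof.
rewrite /norm2 (bigD1 i)//= big1 ?addr0 ?mxE ?eqxx ?expr1n ?sqrtr1//.
by move=> j ji; rewrite mxE (negbTE ji) andbF expr0n.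
Qed.

Lemma quadB (R : realType) (D : nat) (A B : 'M[R]_D) (v : 'rV[R]_D) :
  quad (A - B) v = quad A v - quad B v.
Proof. by rewrite /quad mulmxBr mulmxBl [LHS]mxE [X in _ + X]mxE. Qed.

Lemma ler_quad (R : realType) (D : nat) (A : 'M[R]_D) (v : 'rV[R]_D) (k : R) :
  (forall i j, `|A i j| <= k) -> `|quad A v| <= D%:R ^+ 2 * k * norm2 v ^+ 2.
Proof.
move=> Ak; rewrite quadE.
apply: le_trans (ler_norm_sum _ _ _) _.
have le1 j : `|v 0 j * (\sum_i v 0 i * A i j)| <= D%:R * k * norm2 v ^+ 2.
  rewrite normrM.
  have -> : D%:R * k * norm2 v ^+ 2 = norm2 v * (\sum_(i < D) k * norm2 v).
    by rewrite sumr_const card_ord -mulr_natl; ring.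
  apply: ler_pM; rewrite ?ler_coord_norm2//.
  apply: le_trans (ler_norm_sum _ _ _) _; apply: ler_sum => i _.
  by rewrite normrM mulrC ler_pM ?ler_coord_norm2.
apply: le_trans (ler_sum _ (fun j _ => le1 j)) _.
rewrite sumr_const card_ord -mulr_natl; lra.
Qed.

(** * Local Lipschitz dependence of the Hessian form on the base point *)

(** The ball is convex, so the mean value point on the segment from [z] to [y] stays in it, where
    the partials are bounded by [b]. *)
Lemma partial_bounded_lipschitz (R : realType) (D k : nat) (f : 'rV[R]_D -> R)
    (x : 'rV[R]_D) (r b : R) :
  Ck_on k.+1 setT f -> (forall y i, `|x - y| < r -> `|partial i f y| <= b) ->
  forall y z, `|x - y| < r -> `|x - z| < r -> `|f y - f z| <= D%:R * b * `|y - z|.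
Proof.
move=> hf fb y z xy xz.
have [c] : exists2 c : R, c \in `[0, 1] & f y - f z =
    \sum_i (y - z) 0 i * partial i f (z + c *: (y - z)).
  have dg (t : R) : is_derive t 1 (fun t : R => f (z + t *: (y - z)))
      (\sum_i (y - z) 0 i * partial i f (z + t *: (y - z))).
    exact/is_derive_line/(is_derive_partial _ _ hf).
  have [|c c01] := MVT_segment (@ler01 R) (fun t _ => dg t).
    by apply: derivable_within_continuous => t _; apply: ex_derive.
  by rewrite scale0r scale1r addr0 subr0 mulr1 (addrC z) subrK; exists c.
rewrite in_itv/= => /andP[c0 c1] ->.
apply: le_trans (ler_norm_sum _ _ _) _.
have -> : D%:R * b * `|y - z| = \sum_(i < D) `|y - z| * b.
  by rewrite sumr_const card_ord -mulr_natl; ring.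
apply: ler_sum => i _; rewrite normrM ler_pM ?ler_coord_mxnorm// fb//.
have -> : x - (z + c *: (y - z)) = c *: (x - y) + (1 - c) *: (x - z).
  by rewrite scalerBl !scalerBr scale1r; apply/matrixP => p q; rewrite !mxE; ring.
apply: le_lt_trans (ler_normD _ _) _; rewrite !normrZ (ger0_norm c0) ger0_norm ?subr_ge0//.
(* The strict inequality is obtained from the term with weight [c], so [c = 0] is handled apart. *)
have [->|c0'] := eqVneq c 0; first by rewrite subr0 mul0r mul1r add0r.
have {c0'} : 0 < c by rewrite lt_neqAle eq_sym c0'.
move=> cp; have : c * `|x - y| < c * r by rewrite ltr_pM2l.
have : (1 - c) * `|x - z| <= (1 - c) * r by rewrite ler_wpM2l ?subr_ge0// ltW.
lra.
Qed.

(** The bound is strict so that, for continuous functions bounded at a point, it persists on a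
    neighbourhood. *)
Lemma finite_bound (R : realType) (T : finType) (g : T -> R) :
  exists2 b, 0 <= b & forall t, g t < b.
Proof.
exists (\sum_t `|g t| + 1); first by rewrite addr_ge0// sumr_ge0.
move=> t; apply: le_lt_trans (ler_norm _) _; rewrite ltr_pwDr//.
by rewrite (bigD1 t)//= lerDl sumr_ge0.
Qed.

(** The finitely many third partials are bounded by one [b] near [x], so each Hessian entry is
    Lipschitz there with constant [D b]; [ler_quad] turns this entrywise estimate into one on the
    form. *)
Lemma quad_hessian_lipschitz (R : realType) (D k : nat) (f : 'rV[R]_D -> R)
    (x : 'rV[R]_D) :
  Ck_on k.+3 setT f ->
  exists r K : R, [/\ 0 < r, 0 <= K & forall y z v, `|x - y| < r -> `|x - z| < r ->
    `|quad (hessian f y) v - quad (hessian f z) v| <= K * `|y - z| * norm2 v ^+ 2].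
Proof.
move=> hf.
have h3 a b c : continuous (partial c (partial a (partial b f))).
  exact/Ck_on_continuous/Ck_on_partial/Ck_on_partial/Ck_on_partial/hf.
have h2 a b : Ck_on k.+1 setT (partial a (partial b f)).
  exact/Ck_on_partial/Ck_on_partial/hf.
have [b b0 bP] := finite_bound (fun t : 'I_D * 'I_D * 'I_D =>
  `|partial t.2 (partial t.1.1 (partial t.1.2 f)) x|).
pose small (t : 'I_D * 'I_D * 'I_D) : set 'rV[R]_D :=
  [set y | `|partial t.2 (partial t.1.1 (partial t.1.2 f)) y| <= b].
have : \forall y \near x, forall t, small t y.
  apply: (@filter_forall _ _ small (nbhs x) _) => t.
  near=> y; apply: ltW; near: y.
  exact: cvgr_norm_lt (h3 t.1.1 t.1.2 t.2 x) _ (bP t).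
move=> /nbhs_normP[r r0 Hr]; exists r, (D%:R ^+ 2 * (D%:R * b)); split => //.
  by rewrite !mulr_ge0.
move=> y z v xy xz.
have -> : quad (hessian f y) v - quad (hessian f z) v =
    quad (hessian f y - hessian f z) v.
  by rewrite quadB.
rewrite -(mulrA (_ ^+ 2)); apply: ler_quad => p q.
have hE w : hessian f w p q = partial p (partial q f) w by rewrite mxE.
have subE (A B : 'M[R]_D) : (A - B) p q = A p q - B p q by rewrite !mxE.
rewrite subE [X in `|X - _| <= _]hE [X in `|_ - X| <= _]hE.
apply: (partial_bounded_lipschitz (x := x) (r := r) (h2 p q)) => // w l xw.
exact: (Hr w xw (p, q, l)).
Unshelve. all: by end_near. Qed.


(** * The largest eigenvalue as the maximum of the Rayleigh quotient *)

Lemma continuous_sum (R : realType) (T : topologicalType) (I : finType)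
    (f : I -> T -> R) :
  (forall i, continuous (f i)) -> continuous (fun x => \sum_i f i x).
Proof. by move=> cf; apply: continuous_big => //; exact: add_continuous. Qed.

Lemma quad_continuous (R : realType) (D : nat) (A : 'M[R]_D) : continuous (quad A).
Proof.
have -> : quad A = fun v => \sum_j v 0 j * \sum_i v 0 i * A i j.
  by apply/funext => v; rewrite quadE.
apply: continuous_sum => j v; apply: (@cvgM _ _ (nbhs v) _ (fun v : 'rV_D => v 0 j)).
  exact: coord_continuous.
apply: continuous_sum => i {}v.
apply: (@cvgM _ _ (nbhs v) _ (fun v : 'rV_D => v 0 i) (cst (A i j))).
  exact: coord_continuous.
exact: cvg_cst.
Qed.

Lemma norm2_continuous (R : realType) (D : nat) : continuous (@norm2 R D).
Proof.
move=> v; apply: (@continuous_comp _ _ _ (fun v : 'rV[R]_D => \sum_i v 0 i ^+ 2)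
  Num.sqrt); last exact: sqrt_continuous.
apply: continuous_sum => i {}v.
apply: (@cvgM _ _ (nbhs v) _ (fun v : 'rV_D => v 0 i) (fun v : 'rV_D => v 0 i)).
  exact: coord_continuous.
exact: coord_continuous.
Qed.

Lemma norm2_gt0 (R : realType) (D : nat) (v : 'rV[R]_D) : v != 0 -> 0 < norm2 v.
Proof. by move=> v0; apply: lt_le_trans (ler_mxnorm_norm2 v); rewrite normr_gt0. Qed.

Lemma norm2Z (R : realType) (D : nat) (a : R) (v : 'rV[R]_D) :
  norm2 (a *: v) = `|a| * norm2 v.
Proof.
rewrite /norm2; under eq_bigr do rewrite mxE exprMn.
by rewrite -mulr_sumr sqrtrM ?sqr_ge0// sqrtr_sqr.
Qed.

Lemma quadZ (R : realType) (D : nat) (A : 'M[R]_D) (a : R) (v : 'rV[R]_D) :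
  quad A (a *: v) = a ^+ 2 * quad A v.
Proof. by rewrite /quad linearZ/= -!scalemxAl -scalemxAr scalerA mxE expr2. Qed.

(** The form attains its maximum on the compact Euclidean unit sphere, which is nonempty because
    [0 < D]; homogeneity extends the inequality to all vectors. *)
Lemma quad_max (R : realType) (D : nat) (A : 'M[R]_D) : (0 < D)%N ->
  exists2 v, norm2 v = 1 & forall w, quad A w <= quad A v * norm2 w ^+ 2.
Proof.
case: D A => // D A _.
pose S := [set v : 'rV[R]_D.+1 | norm2 v = 1].
have S0 : S !=set0 by exists (delta_mx 0 0); rewrite /S/= norm2_delta.
have cS : compact S.
  apply: bounded_closed_compact.
    exists 1; split => // t t1 v /= v1.
    by apply: le_trans (ler_mxnorm_norm2 v) _; rewrite v1 ltW.
  rewrite (_ : S = @norm2 R D.+1 @^-1` [set x | x = 1])//.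
  by apply: preimage_closed; [move=> v _; exact: norm2_continuous|exact: closed_eq].
have [|v] := EVT_max_rV S0 cS (f := quad A).
  exact/continuous_subspaceT/quad_continuous.
rewrite inE => v1 maxv; exists v => // w.
have [->|w0] := eqVneq w 0.
  by rewrite norm20 expr0n/= mulr0 /quad mul0mx mul0mx mxE.
have n0 := norm2_gt0 w0.
have := maxv ((norm2 w)^-1 *: w); rewrite inE /S/= norm2Z quadZ.
rewrite ger0_norm ?invr_ge0 ?norm2_ge0// mulVf ?gt_eqF// => /(_ erefl).
by rewrite exprVn mulrC ler_pdivrMr// exprn_gt0.
Qed.

Lemma quadD (R : realType) (D : nat) (A : 'M[R]_D) (v w : 'rV[R]_D) :
  quad A (v + w) =
    quad A v + (v *m A *m w^T) 0 0 + (w *m A *m v^T) 0 0 + quad A w.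
Proof.
have addE (P Q : 'M[R]_1) : (P + Q) 0 0 = P 0 0 + Q 0 0 by rewrite mxE.
by rewrite /quad linearD/= !mulmxDl !mulmxDr !addE; ring.
Qed.

(** For every [w], nonnegativity of the form at [v + t w] for all real [t] forces the cross term [p]
    to vanish, since the constant term is zero. *)
Lemma psd_null (R : realType) (D : nat) (B : 'M[R]_D) (v : 'rV[R]_D) :
  B^T = B -> (forall w, 0 <= quad B w) -> quad B v = 0 -> v *m B = 0.
Proof.
move=> symB B0 Bv.
have vBw (w : 'rV[R]_D) : (v *m B *m w^T) 0 0 = 0.
  set p := (v *m B *m w^T) 0 0.
  have symE : (w *m B *m v^T) 0 0 = p.
    have -> : w *m B *m v^T = (v *m B *m w^T)^T.
      by rewrite !trmx_mul trmxK symB mulmxA.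
    by rewrite mxE.
  have H (t : R) : 0 <= t * (2 * p + t * quad B w).
    have := B0 (v + t *: w).
    rewrite quadD Bv quadZ linearZ/= -!scalemxAl -scalemxAr.
    have scaleE (P : 'M[R]_1) : (t *: P) 0 0 = t * P 0 0 by rewrite mxE.
    by rewrite !scaleE symE -/p; congr (_ <= _); ring.
  have q0 := B0 w.
  apply/eqP/negPn/negP => p0.
  have {}q1 : 0 < quad B w + 1 by rewrite ltr_wpDl.
  (* The natural choice [- p / quad B w] is shifted by 1 in the denominator to cover [quad B w = 0];
     the value is still negative when [p] is nonzero. *)
  have := H (- p / (quad B w + 1)).
  have -> : - p / (quad B w + 1) * (2 * p + - p / (quad B w + 1) * quad B w) =
    - (p ^+ 2 / (quad B w + 1) ^+ 2 * (quad B w + 2)).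
    by field; rewrite gt_eqF.
  rewrite oppr_ge0 leNgt => /negP; apply.
  apply: mulr_gt0; last by rewrite ltr_wpDl.
  by apply: divr_gt0; [rewrite exprn_even_gt0|exact: exprn_gt0].
apply/rowP => j; have := vBw (delta_mx 0 j).
by rewrite trmx_delta -colE mxE => ->; rewrite mxE.
Qed.

(* A maximizer of the Rayleigh quotient, of value m, is a null vector of the
   positive semidefinite matrix m - A, hence an eigenvector. *)
Lemma lambda1_quad (R : realType) (D : nat) (A : 'M[R]_D) :
  (0 < D)%N -> A^T = A ->
  exists v, [/\ norm2 v = 1, quad A v = lambda1 A &
    forall w, quad A w <= lambda1 A * norm2 w ^+ 2].
Proof.
move=> D0 symA; have [v v1 maxv] := quad_max A D0.
set m := quad A v in maxv.
have quadB w : quad (m%:M - A) w = m * norm2 w ^+ 2 - quad A w.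
  by rewrite quadB sqr_norm2_mx /quad mul_mx_scalar -scalemxAl mxE.
have vA : v *m A = m *: v.
  have : v *m (m%:M - A) = 0.
    apply: psd_null.
    - by rewrite linearB/= tr_scalar_mx symA.
    - by move=> w; rewrite quadB subr_ge0.
    - by rewrite quadB v1 expr1n mulr1 subrr.
  by move=> /eqP; rewrite mulmxBr mul_mx_scalar subr_eq0 => /eqP.
have mE : eigenvalue A m.
  apply/eigenvalueP; exists v => //; apply/eqP => v0.
  by move: v1; rewrite v0 norm20 => /esym/eqP; rewrite oner_eq0.
have ubm : ubound [set a : R | eigenvalue A a] m.
  move=> a /eigenvalueP[w wA w0].
  have := maxv w; rewrite {1}/quad wA -scalemxAl mxE -sqr_norm2_mx.
  by rewrite ler_pM2r// exprn_gt0// norm2_gt0.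
have lE : lambda1 A = m.
  apply/eqP; rewrite eq_le ge_sup//=; last by exists m.
  by apply: ub_le_sup => //; exists m.
by exists v; rewrite lE.
Qed.

(** Each form is tested at the unit maximizer of the other one. *)
Lemma lambda1_dist (R : realType) (D : nat) (A B : 'M[R]_D) (k : R) :
  (0 < D)%N -> A^T = A -> B^T = B ->
  (forall v, `|quad A v - quad B v| <= k * norm2 v ^+ 2) ->
  `|lambda1 A - lambda1 B| <= k.
Proof.
move=> D0 symA symB AB.
have [v [v1 vE vle]] := lambda1_quad D0 symA.
have [w [w1 wE wle]] := lambda1_quad D0 symB.
have := AB v; have := AB w; have := vle w; have := wle v.
rewrite v1 w1 vE wE expr1n !mulr1.
move: (quad A w) (quad B v) (lambda1 A) (lambda1 B) => p q a b.
by rewrite !ler_norml; lra.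
Qed.

(** * Sharpness estimates, uniform near a point *)

Lemma max_sharpness_ge (R : realType) (D : nat) (L : 'rV[R]_D -> R) rho x v a :
  norm2 v <= 1 -> a <= L (x + rho *: v) - L x -> (a%:E <= max_sharpness L rho x)%E.
Proof.
move=> v1 aL; rewrite /max_sharpness leeBrDr//.
apply: (@le_trans _ _ (L (x + rho *: v))%:E).
  by rewrite -EFinD lee_fin -lerBrDr.
by apply: ereal_sup_ubound; exists v.
Qed.

Lemma max_sharpness_le (R : realType) (D : nat) (L : 'rV[R]_D -> R) rho x a :
  (forall v, norm2 v <= 1 -> L (x + rho *: v) - L x <= a) ->
  (max_sharpness L rho x <= a%:E)%E.
Proof.
move=> aL; rewrite /max_sharpness leeBlDr//.
apply: ge_ereal_sup => _ [v v1 <-].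
by rewrite -EFinD lee_fin -lerBlDr aL.
Qed.

Lemma max_sharpness_ge0 (R : realType) (D : nat) (L : 'rV[R]_D -> R) rho x :
  (0 <= max_sharpness L rho x)%E.
Proof.
by apply: (@max_sharpness_ge _ _ _ _ _ 0); rewrite ?norm20// scaler0 addr0 subrr.
Qed.

(** Fermat's rule on the coordinate line through [x], over an interval short enough to stay in the
    ball where [x] is minimal. *)
Lemma partial_local_minimizer (R : realType) (D k : nat) (L : 'rV[R]_D -> R) x i :
  Ck_on k.+1 setT L -> local_minimizer L x -> partial i L x = 0.
Proof.
move=> hL /nbhs_normP[r /= r0 minL].
pose g (t : R) := L (x + t *: delta_mx 0 i).
have dg (t : R) : is_derive t 1 g (partial i L (x + t *: delta_mx 0 i)).
  exact/is_derive_line/(Ck_on_is_derive _ _ hL).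
pose e := r / (`|delta_mx 0 i : 'rV[R]_D| + 1).
have e0 : 0 < e by rewrite divr_gt0// ltr_wpDl.
have [] := @derive1_at_min _ g (- e) e 0.
- by rewrite ge0_cp// ltW.
- by move=> t _; apply: ex_derive.
- by rewrite in_itv/= oppr_lt0 e0.
- move=> t; rewrite in_itv/= => /andP[et te].
  rewrite /g scale0r addr0; apply: minL => /=.
  rewrite opprD addrA subrr add0r normrN normrZ.
  have te' : `|t| < e by rewrite ltr_norml et.
  apply: (@le_lt_trans _ _ (`|t| * (`|delta_mx 0 i : 'rV[R]_D| + 1))).
    by rewrite ler_wpM2l// lerDl.
  by rewrite -ltr_pdivlMr// ltr_wpDl.
- move=> _; rewrite derive_val; by rewrite scale0r addr0.
Qed.

Lemma lambda1_hessian_lipschitz (R : realType) (D k : nat) (f : 'rV[R]_D -> R)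
    (x : 'rV[R]_D) (r K : R) :
  (0 < D)%N -> Ck_on k.+2 setT f ->
  (forall y z v, `|x - y| < r -> `|x - z| < r ->
    `|quad (hessian f y) v - quad (hessian f z) v| <= K * `|y - z| * norm2 v ^+ 2) ->
  forall y z, `|x - y| < r -> `|x - z| < r ->
    `|lambda1 (hessian f y) - lambda1 (hessian f z)| <= K * `|y - z|.
Proof.
move=> D0 hf HK y z xy xz.
by apply: lambda1_dist => //; [exact: trmx_hessian hf..|move=> v; exact: HK].
Qed.

(** Real arithmetic with the matrix terms abstracted: [p] and [q] stand for the Hessian form at two
    points at distance [d], and [s] for a step length bounding [d]. *)
Lemma dist_le_bound (R : realFieldType) (p q l K d s n : R) :
  p = l -> n = 1 -> `|p - q| <= K * d * n ^+ 2 -> 0 <= K -> d <= s ->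
  q <= l + K * s.
Proof.
move=> -> ->; rewrite expr1n mulr1 ler_norml => /andP[H _] K0 ds.
have : K * d <= K * s by rewrite ler_wpM2l.
lra.
Qed.

(** If [l < 0], a short step [s] along a unit top eigenvector changes [L] by at most
    [(l + K s) s ^ 2 / 2 < 0], against local minimality. *)
Lemma lambda1_hessian_ge0 (R : realType) (D k : nat) (L : 'rV[R]_D -> R) x :
  (0 < D)%N -> Ck_on k.+3 setT L -> local_minimizer L x ->
  0 <= lambda1 (hessian L x).
Proof.
move=> D0 hL minx.
have [r [K [r0 K0 HK]]] := quad_hessian_lipschitz x hL.
have [v [v1 vE _]] := lambda1_quad D0 (trmx_hessian x hL).
move: (minx) => /nbhs_normP[r' /= r0' minL].
have {}v1' : `|v| <= 1 by rewrite -v1 ler_mxnorm_norm2.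
move: (lambda1 _) vE => l vE.
rewrite leNgt; apply/negP => l0.
(* The three bounds keep the segment in the Lipschitz ball and in the minimality ball, and make
   [l + K s] negative. *)
pose m := Num.min (Num.min r r') (- l / (K + 1)).
have K1 : 0 < K + 1 by rewrite ltr_wpDl.
have m0 : 0 < m by rewrite !lt_min r0 r0' divr_gt0// oppr_gt0.
pose s := m / 2.
have s0 : 0 < s by rewrite divr_gt0.
have sm : s < m by rewrite /s ltr_pdivrMr// ltr_pMr// ltr1n.
have : s < Num.min (Num.min r r') (- l / (K + 1)) by [].
rewrite !lt_min => /andP[/andP[sr sr']]; rewrite ltr_pdivlMr// => sK.
have tv (t : R) : 0 <= t <= s -> `|x - (x + t *: v)| <= s.
  move=> /andP[t0 ts]; rewrite opprD addrA subrr add0r normrN normrZ ger0_norm//.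
  by rewrite -[s]mulr1 ler_pM.
have := @line_taylor_le _ _ _ L x v s (l + K * s) hL (ltW s0).
rewrite big1; last first.
  by move=> i _; rewrite (partial_local_minimizer _ hL) ?mulr0.
rewrite mul0r addr0 => /(_ _)/wrap[].
  move=> t ts; have st := tv t ts.
  have qt : `|quad (hessian L x) v - quad (hessian L (x + t *: v)) v| <=
      K * `|x - (x + t *: v)| * norm2 v ^+ 2.
    by apply: HK; [rewrite subrr normr0|exact: le_lt_trans st sr].
  exact: dist_le_bound vE v1 qt K0 st.
move=> H.
have := minL (x + s *: v) => /(_ (le_lt_trans (tv s _) sr')).
rewrite lexx (ltW s0) => /(_ isT) H'.
have : (l + K * s) * s ^+ 2 < 0.
  rewrite pmulr_llt0 ?exprn_gt0//; lra.
lra.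
Qed.

(** Here [n] is the squared norm of a direction in the unit ball; [0 <= l] is what allows [l n] to
    be replaced by [l]. *)
Lemma le_add_of_dist (R : realFieldType) (p q l e n : R) :
  `|p - q| <= e * n -> p <= l * n -> 0 <= l -> 0 <= e -> n <= 1 -> q <= l + e.
Proof.
rewrite ler_norml => /andP[pq _] pl l0 e0 n1.
have : (l + e) * n <= (l + e) * 1 by rewrite ler_wpM2l// addr_ge0.
lra.
Qed.

Lemma ge_sub_of_dist (R : realFieldType) (p q l e n : R) :
  `|p - q| <= e * n ^+ 2 -> p = l -> n = 1 -> l - e <= q.
Proof.
move=> pq pl n1; move: pq.
by rewrite pl n1 expr1n mulr1 ler_norml => /andP[_]; lra.
Qed.

Lemma dist_half_le (R : realFieldType) (p q K d e : R) :
  `|p - q| <= K * d -> 0 <= d -> d * (K + 1) < e -> `|p / 2 - q / 2| <= e.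
Proof. by rewrite !ler_norml => /andP[]; lra. Qed.

Lemma max_sharpness_bounds (R : realType) (D k : nat) (L : 'rV[R]_D -> R)
    (xs : 'rV[R]_D) :
  (0 < D)%N -> Ck_on k.+3 setT L ->
  exists V : set 'rV[R]_D, [/\ open V, V xs &
    forall C eps : R, 0 < C -> 0 < eps ->
      exists2 rhos : R, 0 < rhos &
        forall x rho, local_minimizer L x -> V x -> 0 < rho -> rho <= rhos ->
          (max_sharpness L rho x <=
             ((lambda1 (hessian L x) / 2 + eps) * rho ^+ 2)%:E)%E /\
          forall x', norm2 (x' - x) <= C * rho ->
            (((lambda1 (hessian L x) / 2 - eps) * rho ^+ 2)%:E
               <= max_sharpness L rho x')%E].
Proof.
move=> D0 hL; have [r [K [r0 K0 HK]]] := quad_hessian_lipschitz xs hL.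
have r20 : 0 < r / 2 by rewrite divr_gt0.
(* Half of the Lipschitz radius is spent on [x], the other half on the displacement from [x]. *)
exists (ball xs (r / 2)); split; [exact: ball_open|exact: ballxx|].
move=> C eps C0 eps0.
pose m := Num.min (r / 2) (eps / (K + 1)).
have K1 : 0 < K + 1 by rewrite ltr_wpDl.
have C1 : 0 < C + 1 by rewrite addr_gt0.
have m0 : 0 < m by rewrite lt_min r20 divr_gt0.
(* Every point used lies within [C rho + rho] of [x]: the offset of [x'] plus a move of length at
   most [rho]. *)
exists (m / (C + 1)); first by rewrite divr_gt0.
move=> x rho minx xsx rho0; rewrite ler_pdivlMr// mulrC => rhom.
have {}xsx : `|xs - x| < r / 2 by move: xsx; rewrite -ball_normE.
have Hz z v : `|x - z| <= (C + 1) * rho ->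
    `|quad (hessian L x) v - quad (hessian L z) v| <= eps * norm2 v ^+ 2.
  move=> /le_trans/(_ rhom) xz.
  have [xz1 xz2] : `|x - z| <= r / 2 /\ `|x - z| * (K + 1) <= eps.
    by rewrite -ler_pdivlMr//; apply/andP; rewrite -le_min.
  apply: le_trans (HK _ _ _ _ _) _.
  - by apply: lt_trans xsx _; rewrite ltr_pdivrMr// ltr_pMr// ltr1n.
  - rewrite -(subrK x xs) -addrA (splitr r).
    by apply: le_lt_trans (ler_normD _ _) _; apply: ltr_leD.
  - rewrite ler_wpM2r ?exprn_ge0 ?norm2_ge0//; apply: le_trans xz2.
    by rewrite mulrC ler_wpM2l// lerDl.
have l0 := lambda1_hessian_ge0 D0 hL minx.
have [v [v1 vE maxv]] := lambda1_quad D0 (trmx_hessian x hL).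
move: (lambda1 _) vE l0 maxv => l vE l0 maxv.
have le_rho (t : R) (w : 'rV[R]_D) : 0 <= t <= rho -> norm2 w <= 1 -> `|t *: w| <= rho.
  move=> /andP[t0 ts] w1; rewrite normrZ ger0_norm// -[leRHS]mulr1.
  by apply: ler_pM => //; apply: le_trans w1; exact: ler_mxnorm_norm2.
have Crho : 0 <= C * rho by rewrite mulr_ge0// ltW.
have epsrho : 0 < eps * rho ^+ 2 by rewrite mulr_gt0// exprn_gt0.
split.
  apply: max_sharpness_le => w w1.
  have := @line_taylor_le _ _ _ L x w rho (l + eps) hL (ltW rho0).
  rewrite big1; last first.
    by move=> i _; rewrite (partial_local_minimizer _ hL) ?mulr0.
  rewrite mul0r addr0 => /(_ _)/wrap[].
    move=> t ts.
    have xt : `|x - (x + t *: w)| <= (C + 1) * rho.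
      rewrite opprD addrA subrr add0r normrN mulrDl mul1r.
      by apply: le_trans (le_rho t w ts w1) _; rewrite lerDr.
    have n1 : norm2 w ^+ 2 <= 1 by rewrite exprn_ile1// norm2_ge0.
    exact: le_add_of_dist (Hz _ w xt) (maxv w) l0 (ltW eps0) n1.
  lra.
move=> x' xx'.
(* Passing from [v] to [- v] keeps the quadratic term and flips the first-order one. *)
have [w [w1 wE dw]] : exists w, [/\ norm2 w = 1, quad (hessian L x) w = l &
    0 <= \sum_i w 0 i * partial i L x'].
  have [dv|dv] := leP 0 (\sum_i v 0 i * partial i L x'); first by exists v.
  exists (- v); split; [by rewrite norm2N|by rewrite quadN|].
  under eq_bigr do rewrite mxE mulNr.
  by rewrite sumrN oppr_ge0 ltW.
apply: (@max_sharpness_ge _ _ _ _ _ w); first by rewrite w1.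
have := @line_taylor_ge _ _ _ L x' w rho (l - eps) hL (ltW rho0).
move=> /(_ _)/wrap[].
  move=> t ts.
  have xt : `|x - (x' + t *: w)| <= (C + 1) * rho.
    rewrite opprD addrA mulrDl mul1r; apply: le_trans (ler_normB _ _) _.
    apply: lerD; last by apply: le_rho => //; rewrite w1.
    by rewrite distrC; apply: le_trans xx'; exact: ler_mxnorm_norm2.
  exact: ge_sub_of_dist (Hz _ w xt) wE w1.
have := mulr_ge0 dw (ltW rho0).
lra.
Qed.

(** * Normalized infima over balls and their limit as the radius shrinks *)

Section inf_ball_theory.
Local Open Scope ereal_scope.

(** The upper bound is needed only at the centre, which belongs to the ball; the lower bound is
    needed on the whole ball. *)
Lemma inf_ball_bounds (R : realType) (D : nat) (Rg : R -> 'rV[R]_D -> \bar R)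
    (x : 'rV[R]_D) (rho r a b : R) : (0 < rho)%R -> (0 <= r)%R ->
  Rg rho x <= (b * rho ^+ 2)%:E ->
  (forall x', (norm2 (x' - x) <= r)%R -> (a * rho ^+ 2)%:E <= Rg rho x') ->
  a%:E <= inf_ball Rg rho r x <= b%:E.
Proof.
move=> rho0 r0 Rb Ra; have rho20 : (0 < rho ^+ 2)%R by rewrite exprn_gt0.
have invE : (rho ^+ 2)%:E^-1 = ((rho ^+ 2)^-1)%:E by rewrite inver gt_eqF.
apply/andP; split.
  apply: le_ereal_inf_tmp => _ [x' xx' <-].
  by rewrite invE lee_pdivlMr// -EFinM Ra.
apply: (@le_trans _ _ (Rg rho x / (rho ^+ 2)%:E)).
  by apply: ereal_inf_lbound; exists x => //=; rewrite subrr norm20.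
by rewrite invE lee_pdivrMr// -EFinM.
Qed.

Lemma lte_dist_half (R : realType) (S e : R) (l : \bar R) : (0 < e)%R ->
  (S - e / 2)%:E <= l <= (S + e / 2)%:E -> `|S%:E - l| < e%:E.
Proof.
case: l => [l| |] e0 /andP[]; rewrite ?leye_eq ?leeNy_eq// !lee_fin.
by move=> l1 l2; rewrite -EFinB lte_fin ltr_norml; lra.
Qed.

Lemma inf_ball_nonincreasing (R : realType) (D : nat)
    (Rg : R -> 'rV[R]_D -> \bar R) (x : 'rV[R]_D) (rho : R) :
  {homo (inf_ball Rg rho ^~ x) : r s / (r <= s)%R >-> s <= r}.
Proof.
move=> r s rs; apply: ereal_inf_le_tmp => _ [x' xx' <-].
by exists x' => //=; exact: le_trans xx' rs.
Qed.

(** The limit exists by monotonicity in the radius, and the bounds of [inf_ball_bounds] hold for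
    every radius below [r]. *)
Lemma lim_inf_ball_bounds (R : realType) (D : nat)
    (Rg : R -> 'rV[R]_D -> \bar R) (x : 'rV[R]_D) (rho r a b : R) :
  (0 < rho)%R -> (0 < r)%R ->
  Rg rho x <= (b * rho ^+ 2)%:E ->
  (forall x', (norm2 (x' - x) <= r)%R -> (a * rho ^+ 2)%:E <= Rg rho x') ->
  a%:E <= lim (inf_ball Rg rho s x @[s --> 0^'+]) <= b%:E.
Proof.
move=> rho0 r0 Rb Ra.
have cvg_inf : cvg (inf_ball Rg rho s x @[s --> 0^'+]).
  apply: nonincreasing_at_right_is_cvge; near=> e => s t _ _.
  exact: inf_ball_nonincreasing.
have near_r : \forall s \near 0^'+, a%:E <= inf_ball Rg rho s x <= b%:E.
  near=> s; apply: inf_ball_bounds => // x' xx'; apply: Ra.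
  apply: le_trans xx' _; near: s; exact: nbhs_right_le.
by apply/andP; split; [apply: lime_ge => //|apply: lime_le => //];
  apply: filterS near_r => s /andP[].
Unshelve. all: by end_near. Qed.
End inf_ball_theory.

Theorem theoremE3 (R : realType) (D M : nat) (hM : (1 <= M <= D)%N)
    (L : 'rV[R]_D -> R) (hL : Ck_on 4 setT L)
    (Gamma : set 'rV[R]_D) (hGamma : is_submanifold 2 (D - M) Gamma)
    (hmin : forall x, Gamma x -> local_minimizer L x)
    (hrank : forall x, Gamma x -> \rank (hessian L x) = M) :
  admits_good_limiting_regularizer (max_sharpness L)
    (fun x => lambda1 (hessian L x) / 2) Gamma /\
  mildly_bounded_below (max_sharpness L) (attraction_set L Gamma).
Proof.
have D0 : (0 < D)%N by case/andP: hM; exact: leq_trans.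
split; last first.
  (* Any positive constant works, as the sharpness is nonnegative. *)
  move=> B _ _ _; exists 1 => //; near=> rho => x _.
  by apply: le_trans (max_sharpness_ge0 L rho x); rewrite lee_fin oppr_le0 mul1r sqr_ge0.
split.
- by move=> rho x _; rewrite gt_eqF// (lt_le_trans _ (max_sharpness_ge0 L rho x)) ?ltNyr.
- move=> x Gx.
  have [V [_ Vx HV]] := max_sharpness_bounds x D0 hL.
  have near_lim (eps : R) : 0 < eps -> \forall rho \near 0^'+,
      ((lambda1 (hessian L x) / 2 - eps)%:E <=
        lim (inf_ball (max_sharpness L) rho r x @[r --> 0^'+]) <=
       (lambda1 (hessian L x) / 2 + eps)%:E)%E.
    (* With [C = 1] the lower bound covers the ball of radius [rho], and the inner limit only
       involves smaller radii. *)
    move=> eps0; have [rhos rhos0 H] := HV 1 eps ltr01 eps0.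
    near=> rho.
    have rho0 : 0 < rho by [].
    have [|up low] := H x rho (hmin _ Gx) Vx rho0.
      by near: rho; exact: nbhs_right_le.
    by apply: (lim_inf_ball_bounds rho0 rho0 up) => x' xx'; apply: low; rewrite mul1r.
  move: (lambda1 _ / 2) near_lim => S near_lim.
  apply/fine_cvgP; split.
    (* The tolerance 1 is arbitrary: it only shows that the inner limit is eventually finite. *)
    apply: filterS (near_lim 1 ltr01) => rho /andP[h1 h2].
    by rewrite fin_real// (lt_le_trans (ltNyr _) h1) (le_lt_trans h2 (ltry _)).
  apply/cvgrPdist_le => eps eps0.
  apply: filterS (near_lim eps eps0) => rho /=.
  move: (lim (inf_ball _ _ _ _ @[_ --> _])) => [l| |] /andP[]; rewrite ?lee_fin.
  - by rewrite ler_norml /=; lra.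
  - by rewrite leye_eq.
  - by rewrite leeNy_eq.
move=> xs Gxs; split.
- by rewrite divr_ge0// (lambda1_hessian_ge0 D0 hL (hmin _ Gxs)).
- have [r [K [r0 K0 HK]]] := quad_hessian_lipschitz xs hL.
  have Hl := lambda1_hessian_lipschitz D0 hL HK.
  (* Continuity is proved at [xs] in the whole space and then restricted to [Gamma]. *)
  apply: cvg_within_filter; apply/cvgrPdist_le => eps eps0.
  have rK : 0 < Num.min r (eps / (K + 1)).
    by rewrite lt_min r0 divr_gt0// ltr_wpDl.
  near=> y.
  have : `|xs - y| < Num.min r (eps / (K + 1)).
    near: y; exact: (@cvgr_dist_lt _ _ _ (nbhs xs) _ id xs).
  rewrite lt_min ltr_pdivlMr ?ltr_wpDl// => /andP[yr yK].
  have xs0 : `|xs - xs| < r by rewrite subrr normr0.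
  exact: dist_half_le (Hl _ _ xs0 yr) (normr_ge0 _) yK.
- have [V [oV Vx HV]] := max_sharpness_bounds xs D0 hL.
  exists V; split => // C eps C0 eps0.
  (* Halving [eps] turns the non-strict bounds into the strict inequality required. *)
  have e20 : 0 < eps / 2 by rewrite divr_gt0.
  have [rhos rhos0 H] := HV C _ C0 e20; exists rhos => // x rho Gx Vx' rho0 rhole.
  have [up low] := H x rho (hmin _ Gx) Vx' rho0 rhole.
  exact: lte_dist_half eps0 (inf_ball_bounds rho0 (ltW (mulr_gt0 C0 rho0)) up low).
Unshelve. all: by end_near. Qed.
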